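(* Let $G$ be a finite acyclic directed graph. For any linear extension $\ell$ and any reverse linear extension $\ell'$ of $G$-order, $$\mathrm{row}=\prod_{g\in\ell}\mathrm{flip}_g=\prod_{g\in\ell'}\mathrm{tog}_g$$ as maps $\mathrm{top}(G)\to\mathrm{top}(G)$. Here the first product is the composition of the flips on $\mathrm{top}(G)$ applied successively in the order of $\ell$ (the first element of $\ell$ is flipped first), and the second product is the composition of the toggle bijections $\mathrm{top}(G_0)\to\mathrm{top}(G_1)\to\cdots\to\mathrm{top}(G_n)$ applied successively in the order of $\ell'=(g_1,\dots,g_n)$, where $n$ is the number of vertices, $G_0=G$, $G_i=\mathrm{tog}_{g_i}(G_{i-1})$ and $G_n=G$.
   Context: All directed graphs are finite, acyclic (no directed cycles, hence no loops) and without multiple edges; $g\in G$ means $g$ is a vertex of $G$, and $g\to h$ denotes an edge from $g$ to $h$. The $G$-order is the partial order on vertices with $g_1\ge g_2$ iff there is a directed path (possibly of length $0$) from $g_1$ to $g_2$. An independent set is a set of pairwise non-adjacent vertices. A pair $(\mathcal D,\mathcal U)$ of disjoint independent sets is orthogonal if there is no edge from an element of $\mathcal D$ to an element of $\mathcal U$. An orthogonal pair of independent sets is tight if none of the following operations results in an orthogonal pair of independent sets: removing some $d\in\mathcal D$ and inserting in $\mathcal D$ an element $d'\notin\mathcal D$ with $d'>d$; removing some $u\in\mathcal U$ and inserting in $\mathcal U$ an element $u'\notin\mathcal U$ with $u'<u$; adding a new element to $\mathcal D$; adding a new element to $\mathcal U$. A tight orthogonal pair is called a top, and $\mathrm{top}(G)$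 is the set of tops of $G$. For every independent set $\mathcal I$ there is a unique top of the form $(\mathcal I,\mathcal U)$ and a unique top of the form $(\mathcal D,\mathcal I)$. Rowmotion: $\mathrm{row}(\mathcal D,\mathcal U)$ is the unique $(\mathcal D',\mathcal U')\in\mathrm{top}(G)$ with $\mathcal U'=\mathcal D$. A linear extension $\ell$ of $G$-order is a total order on the vertices such that if $g_1\to g_2$ is an edge then $g_2$ precedes $g_1$; a reverse linear extension $\ell'$ is a total order in which $g_1$ precedes $g_2$ whenever $g_1\to g_2$. Flips: for $(\mathcal D,\mathcal U)\in\mathrm{top}(G)$ and $g\in G$, define $\mathrm{flip}_g(\mathcal D,\mathcal U)=(\mathcal D,\mathcal U)$ if $g\notin\mathcal D\cup\mathcal U$. Otherwise start with $\mathcal D'=\{k\in\mathcal D: k\not\le g\}$ and $\mathcal U'=\{k\in\mathcal U:k\not\ge g\}$; add $g$ to $\mathcal D'$ if $g\in\mathcal U$, and add $g$ to $\mathcal U'$ if $g\in\mathcal D$. Then, for $k\not\ge g$ in the order of a reverse linear extension, add $k$ to $\mathcal D'$ if $k\notin\mathcal U'$, there is no edge from $k$ to $\mathcal U'$, and there is no edge from the current $\mathcal D'$ to $k$. Then, for $k\not\le g$ in the order of a linear extension, add $k$ to $\mathcal U'$ if $k\notin\mathcal D'$, there is no edge from $\mathcal D'$ to $k$, and there is no edge from $k$ to the current $\mathcal U'$. The result $(\mathcal D',\mathcal U')$ is $\mathrm{flip}_g(\mathcal D,\mathcal U)$; it is a top and does not depend on the choice of linear extensions. Toggles: for $g$ a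 minimal or maximal element of $G$-order, $\mathrm{tog}_g(G)$ is the acyclic directed graph obtained from $G$ by reversing all edges incident to $g$. For $g$ maximal, the toggle bijection $\mathrm{tog}_g:\mathrm{top}(G)\to\mathrm{top}(\mathrm{tog}_g(G))$ sends $(\mathcal D,\mathcal U)$ with $g\in\mathcal D$ to $(\mathcal D\setminus\{g\},\mathcal U\cup\{g\})$, and sends $(\mathcal D,\mathcal U)$ with $g\notin\mathcal D$ to the unique top of $\mathrm{tog}_g(G)$ whose second component is $\mathcal U\setminus\{g\}$. (In the second product each $g_i$ is maximal in $G_{i-1}$.)
   Formalization: In the definition of tight, one or more elements of D may be removed at once when inserting a larger d' (dually for U); with only one removed, tops with a given component are not unique (edges u1→k, u2→k, k→d1, k→d2) and row is undefined. *)

(* Defs.v *)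
From mathcomp Require Import all_boot.
Set Implicit Arguments.
Unset Strict Implicit.
Unset Printing Implicit Defensive.

(** A finite directed graph without multiple edges is a relation [e] on a
    finite type [V]; [e x y] is the edge x -> y.  In the [G]-order, x >= y iff
    [connect e x y]. *)

Section IndependencePoset.
Variable V : finType.
Implicit Types (e : rel V) (D U I : {set V}) (T : {set V} * {set V}).

(* [path.cycle e (x :: p)] is a closed directed walk, a loop if [p] is empty. *)
Definition acyclic e := forall (x : V) (p : seq V), ~~ cycle e (x :: p).

Definition gorder_lt e (x y : V) := (x != y) && connect e y x.

Definition independent e I := [forall x in I, forall y in I, ~~ e x y].

Definition orthogonal_pair e T :=
  [&& independent e T.1, independent e T.2, [disjoint T.1 & T.2]
    & [forall d in T.1, forall u in T.2, ~~ e d u]].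

(** An element d' of the complement of [D] may replace one *or more* smaller
    elements of [D] at once, and dually for [U].  Allowing only one element to
    be replaced would be too weak: in the graph with edges
    u1 -> k, u2 -> k, k -> d1, k -> d2, the pair ({d1,d2}, {u1,u2}) resists
    every replacement of a single element, but so does ({d1,d2}, {k}), and a
    top would not be determined by its first component. *)
Definition tight e T :=
  [&& [forall A : {set V}, forall d',
         [&& A != set0, A \subset T.1, d' \notin T.1
           & [forall d in A, gorder_lt e d d']]
         ==> ~~ orthogonal_pair e (d' |: (T.1 :\: A), T.2)],
      [forall A : {set V}, forall u',
         [&& A != set0, A \subset T.2, u' \notin T.2
           & [forall u in A, gorder_lt e u' u]]
         ==> ~~ orthogonal_pair e (T.1, u' |: (T.2 :\: A))],
      [forall d', (d' \notin T.1) ==> ~~ orthogonal_pair e (d' |: T.1, T.2)]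
    & [forall u', (u' \notin T.2) ==> ~~ orthogonal_pair e (T.1, u' |: T.2)]].

Definition top e T := orthogonal_pair e T && tight e T.

(** The unique top with second component [I]; the default value is irrelevant
    when [e] is acyclic and [I] is independent, see [top_with_snd_spec] and
    [top_with_snd_uniq]. *)
Definition top_with_snd e I : {set V} * {set V} :=
  odflt (set0, I) [pick T | top e T && (T.2 == I)].

Definition row e T := top_with_snd e T.1.

(** A total order on [V] is the list of all vertices, first element first. *)
Definition linear_extension e (l : seq V) :=
  perm_eq l (enum V) /\ forall x y, e x y -> index y l < index x l.

Definition reverse_linear_extension e (l : seq V) :=
  perm_eq l (enum V) /\ forall x y, e x y -> index x l < index y l.

Definition flip_addD e U D (k : V) :=
  if [&& k \notin U, [forall u in U, ~~ e k u] & [forall d in D, ~~ e d k]]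
  then k |: D else D.

Definition flip_addU e D U (k : V) :=
  if [&& k \notin D, [forall d in D, ~~ e d k] & [forall u in U, ~~ e k u]]
  then k |: U else U.

(** [l] and [l'] are the linear and the reverse linear extension used to
    complete the two sets. *)
Definition flip e (l l' : seq V) (g : V) T : {set V} * {set V} :=
  if g \notin T.1 :|: T.2 then T else
  let D0 := [set k in T.1 | ~~ connect e g k] in
  let U0 := [set k in T.2 | ~~ connect e k g] in
  let D1 := if g \in T.2 then g |: D0 else D0 in
  let U1 := if g \in T.1 then g |: U0 else U0 in
  let D2 := foldl (flip_addD e U1) D1 [seq k <- l' | ~~ connect e k g] in
  let U2 := foldl (flip_addU e D2) U1 [seq k <- l | ~~ connect e g k] in
  (D2, U2).

Definition tog_graph (g : V) e : rel V :=
  fun x y => if (x == g) || (y == g) then e y x else e x y.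

(** The toggle bijection at a maximal element [g]. *)
Definition tog e (g : V) T : {set V} * {set V} :=
  if g \in T.1 then (T.1 :\ g, g |: T.2)
  else top_with_snd (tog_graph g e) (T.2 :\ g).

(** A graph together with a pair of sets of vertices of it. *)
Definition tog_step (S : rel V * ({set V} * {set V})) (g : V) :=
  (tog_graph g S.1, tog S.1 g S.2).

(** Composition of successive toggles; the first component is the last graph
    [G_n], the second one the resulting pair. *)
Definition toggles e (l : seq V) T := foldl tog_step (e, T) l.

(** Well-definedness of [top_with_snd], [row] and [tog]. *)

Lemma acyclic_edge e x y : acyclic e -> e x y -> ~~ connect e y x.
Proof.
move=> ac exy; apply/negP => /connectP [p pth lst].
by have /negP := ac y p; apply; rewrite /= rcons_path pth /= -lst exy.
Qed.

Lemma acyclic_lt e x y : acyclic e -> e x y -> gorder_lt e y x.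
Proof.
move=> ac exy; rewrite /gorder_lt connect1 // andbT.
by apply: contraNneq (acyclic_edge ac exy) => ->; rewrite connect0.
Qed.

Lemma gorder_ltNedge e x y : acyclic e -> gorder_lt e x y -> ~~ e x y.
Proof.
move=> ac /andP [_ cyx]; apply/negP => exy.
by have := acyclic_edge ac exy; rewrite cyx.
Qed.

Lemma top_complete e D U : acyclic e ->
  top e (D, U) <->
  orthogonal_pair e (D, U) /\
  forall k, k \notin D -> k \notin U ->
    (exists2 d, d \in D & e d k) \/ (exists2 u, u \in U & e k u).
Proof.
move=> ac; split.
- case/andP => /= orth /and4P [/= /forallP tD _ /forallP aD _]; split=> // k kD kU.
  case: (boolP [exists d in D, e d k]) => [/exists_inP [d dD edk]|nD].
    by left; exists d.
  case: (boolP [exists u in U, e k u]) => [/exists_inP [u uU eku]|nU].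
    by right; exists u.
  exfalso.
  pose A := [set d in D | e k d].
  have AD : A \subset D by apply/subsetP => x; rewrite inE => /andP [].
  case/and4P: orth => /= iD iU dDU oDU.
  have nDk d : d \in D -> ~~ e d k.
    by move=> dD; apply: contra nD => edk; apply/exists_inP; exists d.
  have nkU u : u \in U -> ~~ e k u.
    by move=> uU; apply: contra nU => eku; apply/exists_inP; exists u.
  have ekk : ~~ e k k.
    by apply: contraT => /negbNE /(acyclic_edge ac); rewrite connect0.
  have orth' : orthogonal_pair e (k |: (D :\: A), U).
    apply/and4P; split=> //=.
    + apply/forall_inP => x; rewrite !inE => /orP [/eqP ->|/andP [xA xD]];
        apply/forall_inP => y; rewrite !inE => /orP [/eqP ->|/andP [yA yD]] //.
      * by move: yA; rewrite yD.
      * exact: nDk.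
      * by move/forall_inP: iD => /(_ x xD) /forall_inP; apply.
    + rewrite disjoints_subset; apply/subsetP => x.
      rewrite !inE => /orP [/eqP -> //|/andP [_ xD]].
      by rewrite (disjointFr dDU xD).
    + apply/forall_inP => x; rewrite !inE => /orP [/eqP ->|/andP [_ xD]].
        exact/forall_inP.
      by move/forall_inP: oDU; apply.
  have [A0|An0] := eqVneq A set0.
    by have := aD k; rewrite kD /=; move: orth'; rewrite A0 setD0 => ->.
  have := tD A => /forallP /(_ k); rewrite orth' An0 AD kD /= implybF.
  move/negP; apply; apply/forall_inP => d; rewrite inE => /andP [_ ekd].
  exact: acyclic_lt.
- case=> orth compl; rewrite /top orth /=.
  have HD (A : {set V}) k : {in A, forall d, gorder_lt e d k} -> k \notin D ->
      ~~ orthogonal_pair e (k |: (D :\: A), U).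
    move=> Alt kD; apply/negP => /and4P [/= iD' _ dDU' oDU'].
    have kU : k \notin U by rewrite (disjointFr dDU') // setU11.
    case: (compl k kD kU) => [[d dD edk]|[u uU eku]].
      have dA : d \notin A.
        by apply: contraL edk => /Alt; exact: gorder_ltNedge.
      move/forall_inP: iD' => /(_ d); rewrite !inE dD dA orbT => /(_ isT).
      by move/forall_inP => /(_ k); rewrite setU11 edk => /(_ isT).
    move/forall_inP: oDU' => /(_ k (setU11 _ _)) /forall_inP /(_ u uU).
    by rewrite eku.
  have HU (A : {set V}) k : {in A, forall u, gorder_lt e k u} -> k \notin U ->
      ~~ orthogonal_pair e (D, k |: (U :\: A)).
    move=> Alt kU; apply/negP => /and4P [/= _ iU' dDU' oDU'].
    have kD : k \notin D by rewrite (disjointFl dDU') // setU11.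
    case: (compl k kD kU) => [[d dD edk]|[u uU eku]].
      move/forall_inP: oDU' => /(_ d dD) /forall_inP /(_ k (setU11 _ _)).
      by rewrite edk.
    have uA : u \notin A.
      by apply: contraL eku => /Alt; exact: gorder_ltNedge.
    move/forall_inP: iU' => /(_ k (setU11 _ _)) /forall_inP /(_ u).
    by rewrite !inE uU uA orbT eku => /(_ isT).
  apply/and4P; split=> /=.
  + apply/forallP => A; apply/forallP => k; apply/implyP.
    by case/and4P => _ _ kD /forall_inP Alt; apply: HD.
  + apply/forallP => A; apply/forallP => k; apply/implyP.
    by case/and4P => _ _ kU /forall_inP Alt; apply: HU.
  + apply/forallP => k; apply/implyP => kD.
    by have := HD set0 k; rewrite setD0; apply=> // d; rewrite inE.
  + apply/forallP => k; apply/implyP => kU.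
    by have := HU set0 k; rewrite setD0; apply=> // d; rewrite inE.
Qed.

Definition nancestors e k := #|[set x | connect e x k]|.

Lemma nancestors_edge e x y : acyclic e -> e x y ->
  nancestors e x < nancestors e y.
Proof.
move=> ac exy; apply: proper_card; apply/properP; split.
  apply/subsetP => z; rewrite !inE => czx.
  exact: connect_trans czx (connect1 exy).
by exists y; rewrite !inE ?connect0 // acyclic_edge.
Qed.

Lemma kernel_exists e (ok : pred V) : acyclic e ->
  exists D : {set V}, forall k,
    (k \in D) = ok k && ~~ [exists d in D, e d k].
Proof.
move=> ac.
have main n : exists D : {set V}, forall k,
    (k \in D) = [&& nancestors e k < n, ok k & ~~ [exists d in D, e d k]].
  elim: n => [|n [D HD]]; first by exists set0 => k; rewrite inE.
  exists (D :|: [set k | [&& nancestors e k == n, ok k &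
                           ~~ [exists d in D, e d k]]]) => k.
  set D' := _ :|: _.
  rewrite inE HD inE ltnS [nancestors e k <= n]leq_eqVlt.
  have same : nancestors e k <= n ->
      [exists d in D', e d k] = [exists d in D, e d k].
    move=> kn; apply/exists_inP/exists_inP => -[d dD edk]; exists d => //.
      move: dD; rewrite !inE => /orP [//|/andP [/eqP dn _]].
      by have := leq_trans (nancestors_edge ac edk) kn; rewrite dn ltnn.
    by rewrite inE dD.
  have [lt|gt|eq] /= := ltngtP (nancestors e k) n.
  - by rewrite orbF same // ltnW.
  - by [].
  - by rewrite same // eq.
have [D HD] := main (#|V|).+1; exists D => k.
by rewrite HD ltnS max_card.
Qed.

Lemma top_with_snd_exists e I : acyclic e -> independent e I ->
  exists2 T, top e T & T.2 = I.
Proof.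
move=> ac /forall_inP iI.
have [D HD] := kernel_exists
  (fun k => (k \notin I) && ~~ [exists u in I, e k u]) ac.
exists (D, I) => //; apply/(top_complete _ _ ac); split.
- apply/and4P; split=> /=; last 2 first.
  + rewrite disjoints_subset; apply/subsetP => x.
    by rewrite HD inE => /andP [/andP []].
  + apply/forall_inP => d; rewrite HD => /andP [/andP [_ H] _].
    apply/forall_inP => u uI; apply: contra H => H.
    by apply/exists_inP; exists u.
  + apply/forall_inP => x xD; apply/forall_inP => y.
    rewrite HD => /andP [_ H]; apply: contra H => H.
    by apply/exists_inP; exists x.
  + by apply/forall_inP.
- move=> k; rewrite HD => H kI; move: H; rewrite kI /= negb_and !negbK.
  by case/orP => /exists_inP [x xI exk]; [right|left]; exists x.
Qed.

Lemma top_with_snd_uniq e T1 T2 : acyclic e -> top e T1 -> top e T2 ->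
  T1.2 = T2.2 -> T1 = T2.
Proof.
case: T1 T2 => [D1 U] [D2 U2] ac t1 t2 /= EU; subst U2.
have /(top_complete _ _ ac) [o1 c1] := t1.
have /(top_complete _ _ ac) [o2 c2] := t2.
congr (_, _); apply/setP => k.
have [n le_n] := ubnP (nancestors e k).
elim: n k le_n => // n IHn k /ltnSE le_n.
have aux D D' : orthogonal_pair e (D, U) ->
    (forall k, k \notin D' -> k \notin U ->
       (exists2 d, d \in D' & e d k) \/ (exists2 u, u \in U & e k u)) ->
    (forall x, nancestors e x < n -> (x \in D) = (x \in D')) ->
    k \in D -> k \in D'.
  move=> /and4P [/= iD _ dDU oDU] c' IH kD; apply: contraT => kD'.
  case: (c' k kD'); first by rewrite (disjointFr dDU kD).
    move=> [d dD' edk].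
    have dD : d \in D.
      by rewrite IH //; apply: leq_trans (nancestors_edge ac edk) le_n.
    by move/forall_inP: iD => /(_ d dD) /forall_inP /(_ k kD); rewrite edk.
  move=> [u uU eku].
  by move/forall_inP: oDU => /(_ k kD) /forall_inP /(_ u uU); rewrite eku.
apply/idP/idP; [apply: aux o1 c2 _ | apply: aux o2 c1 _] => x lt_x.
  exact: IHn.
by rewrite IHn.
Qed.

Lemma top_with_snd_spec e I : acyclic e -> independent e I ->
  top e (top_with_snd e I) /\ (top_with_snd e I).2 = I.
Proof.
move=> ac iI; rewrite /top_with_snd; case: pickP => [T /andP [tT /eqP ET] //|].
have [T tT ET] := top_with_snd_exists ac iI.
by move/(_ T); rewrite tT ET eqxx.
Qed.

Lemma row_spec e T : acyclic e -> top e T ->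
  [/\ top e (row e T), (row e T).2 = T.1
    & forall T', top e T' -> T'.2 = T.1 -> T' = row e T].
Proof.
move=> ac tT.
have iD : independent e T.1 by case/andP: tT => /and4P [].
have [tR ER] := top_with_snd_spec ac iD; split=> // T' tT' ET'.
by apply: (top_with_snd_uniq ac tT' tR); rewrite ER.
Qed.

Lemma tog_graph_acyclic e g : acyclic e -> (forall x, ~~ e x g) ->
  acyclic (tog_graph g e).
Proof.
move=> ac gmax x p; apply/negP => cyc.
have [gin|gout] := boolP (g \in x :: p).
  have [i q Eq] := rot_to gin.
  move: cyc; rewrite -(rot_cycle i) Eq; case: q {Eq} => [|y q] /=;
  by rewrite /tog_graph eqxx /= (negPf (gmax _)).
have H : {in mem (x :: p) &, tog_graph g e =2 e}.
  move=> y z yin zin; rewrite /tog_graph.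
  have [E|_] := eqVneq y g; first by rewrite -E yin in gout.
  by have [E|_] := eqVneq z g; first by rewrite -E zin in gout.
have /negP := ac x p; apply; rewrite -(eq_in_cycle H) //.
exact/allP.
Qed.

Lemma tog_graph_indep e g I : independent e I -> g \notin I ->
  independent (tog_graph g e) I.
Proof.
move=> /forall_inP iI gI; apply/forall_inP => x xI; apply/forall_inP => y yI.
rewrite /tog_graph; case: ifP => _.
  by move/forall_inP: (iI y yI); apply.
by move/forall_inP: (iI x xI); apply.
Qed.

Lemma tog_top e g T : acyclic e -> (forall x, ~~ e x g) -> top e T ->
  top (tog_graph g e) (tog e g T).
Proof.
case: T => D U ac gmax tT; rewrite /tog /=.
have ac' := tog_graph_acyclic ac gmax.
have /(top_complete _ _ ac) [/and4P [/= iD iU dDU oDU] compl] := tT.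
case: ifP => gD; last first.
  apply: (proj1 (top_with_snd_spec ac' _)).
  apply: tog_graph_indep; rewrite ?setD11 //.
  apply/forall_inP => x; rewrite inE => /andP [_ xU]; apply/forall_inP => y.
  by rewrite inE => /andP [_ yU]; move/forall_inP: iU => /(_ x xU) /forall_inP; apply.
have eD x y : x \in D -> y \in D -> ~~ e x y.
  by move=> xD yD; move/forall_inP: iD => /(_ x xD) /forall_inP; apply.
have eU x y : x \in U -> y \in U -> ~~ e x y.
  by move=> xU yU; move/forall_inP: iU => /(_ x xU) /forall_inP; apply.
have eDU x y : x \in D -> y \in U -> ~~ e x y.
  by move=> xD yU; move/forall_inP: oDU => /(_ x xD) /forall_inP; apply.
apply/(top_complete _ _ ac'); split.
  apply/and4P; split=> /=.
  - apply: tog_graph_indep; last by rewrite setD11.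
    apply/forall_inP => x; rewrite inE => /andP [_ xD]; apply/forall_inP => y.
    by rewrite inE => /andP [_ yD]; exact: eD.
  - apply/forall_inP => x; rewrite !inE => /orP [/eqP ->|xU];
      apply/forall_inP => y; rewrite !inE => /orP [/eqP ->|yU];
      rewrite /tog_graph ?eqxx ?orbT //=; first exact: eDU.
    by case: ifP => _; apply: eU.
  - rewrite disjoints_subset; apply/subsetP => x; rewrite !inE negb_or.
    by move=> /andP [-> xD]; rewrite (disjointFr dDU xD).
  - apply/forall_inP => x; rewrite !inE => /andP [/negPf xg xD].
    apply/forall_inP => y; rewrite !inE /tog_graph xg /=.
    by have [-> _|_ /= yU] := eqVneq y g; [apply: eD | apply: eDU].
move=> k; rewrite !inE negb_and negbK negb_or.
have [//|kg /= kD kU] := eqVneq k g.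
case: (compl k kD kU) => [[d dD edk]|[u uU eku]].
  have [Ed|dg] := eqVneq d g.
    by right; exists g; rewrite ?setU11 // /tog_graph eqxx orbT -Ed.
  left; exists d; first by rewrite !inE dg.
  by rewrite /tog_graph (negPf dg) (negPf kg).
have ug : u != g.
  by apply: contraTneq uU => ->; rewrite (disjointFr dDU gD).
right; exists u; first by rewrite !inE uU orbT.
by rewrite /tog_graph (negPf ug) (negPf kg).
Qed.

End IndependencePoset.

(* Main.v *)
Require Import Defs.
From mathcomp Require Import all_boot.

(** A top (D, U) is a disjoint pair whose union is exactly its set of free
    vertices, those that receive no edge from D and send no edge to U
    ([top_free]). This description is unchanged when all edges are reversed and
    D and U are exchanged, so each argument about D serves for U as well.

    Let (D, U) be the given top. Rowmotion produces the only top with second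
    component D, so it is enough that each of the two products ends in a top of
    [e] with second component D. Both products move D, one vertex at a time,
    from the first component to the second. Precisely, once the vertices of a
    prefix p of the list have been processed, the current pair (D', U')
    satisfies ([transferred]): U' agrees with D on p, and D' agrees with D off
    p. At the start p is empty and D' = D; at the end p contains every vertex
    and U' = D ([row_of_transferred]).

    For flips ([flip_step]), p is closed downwards, and so is p with the next
    vertex g. If g belongs to the current pair, the flip discards from D' only
    vertices below g, which lie in p or equal g, and from U' only vertices
    above g, which lie off p. So no vertex leaves D' off p and g, or U' on p.
    None enters there either: the completion of D' examines only vertices not
    above g, that of U' only vertices not below g, and for these the
    obstructions that kept them out of the old top survive. That the outcome
    is a top ([flip_top]) also rests on surviving obstructions: they rule out
    the dangerous edges between added vertices and vertices kept from the
    start ([unblocked_no_edge]). The order of completion rules out edges among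
    added vertices ([greedy_orthogonal]), and greediness leaves no free vertex
    out.

    For toggles ([tog_step_transfers]), p is closed upwards, and the current
    graph is [e] with the edges between p and its complement reversed
    ([cut_graph]), so the next vertex is maximal in it and the last graph is
    [e] again. If g is in D', it simply changes sides. Otherwise the second
    component only loses g, and off p and g the first component is determined
    by recursion along edges, none of which comes from p. The vertex g plays no
    part in it either: before the toggle g is not in D', and afterwards no edge
    starts at g. So D' does not change there ([tog_fst_outside]). *)

Set Implicit Arguments.
Unset Strict Implicit.
Unset Printing Implicit Defensive.

(** * Tops and free vertices *)

Section Rowmotion.
Variable V : finType.
Implicit Types (e f : rel V) (D U : {set V}) (T : {set V} * {set V}).

Definition converse e : rel V := fun x y => e y x.

Definition free e D U (k : V) :=
  [forall d in D, ~~ e d k] && [forall u in U, ~~ e k u].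

Lemma freeP e D U k :
  reflect ((forall d, d \in D -> ~~ e d k) /\ (forall u, u \in U -> ~~ e k u))
          (free e D U k).
Proof.
apply: (iffP andP) => -[].
  by move=> /forall_inP HD /forall_inP HU.
by move=> HD HU; split; apply/forall_inP.
Qed.

Lemma free_converse e D U k : free (converse e) U D k = free e D U k.
Proof. exact: andbC. Qed.

Lemma free_sub e D U D' U' k : D \subset D' -> U \subset U' ->
  free e D' U' k -> free e D U k.
Proof.
move=> /subsetP sD /subsetP sU /freeP [HD HU]; apply/freeP.
by split=> x xin; [apply/HD/sD | apply/HU/sU].
Qed.

Lemma orthogonal_free e D U :
  orthogonal_pair e (D, U) <->
  [disjoint D & U] /\ (forall k, k \in D :|: U -> free e D U k).
Proof.
split.
  case/and4P => /= /forall_inP iD /forall_inP iU dDU /forall_inP oDU.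
  split=> // k; rewrite inE => /orP kin; apply/freeP.
  split=> x xin; case: kin => kin.
  - by have /forall_inP := iD x xin; apply.
  - by have /forall_inP := oDU x xin; apply.
  - by have /forall_inP := oDU k kin; apply.
  - by have /forall_inP := iU k kin; apply.
case=> dDU H; apply/and4P; split=> //=;
  apply/forall_inP => x xin; apply/forall_inP => y yin.
- by have /freeP [/(_ x xin)] : free e D U y by apply: H; rewrite inE yin.
- by have /freeP [_ /(_ y yin)] : free e D U x
    by apply: H; rewrite inE xin orbT.
- by have /freeP [_ /(_ y yin)] : free e D U x by apply: H; rewrite inE xin.
Qed.

Lemma orthogonal_converse e D U :
  orthogonal_pair (converse e) (U, D) <-> orthogonal_pair e (D, U).
Proof.
split=> /orthogonal_free [dDU H]; apply/orthogonal_free;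
  by rewrite disjoint_sym; split=> // k; rewrite setUC => /H;
     rewrite free_converse.
Qed.

(** If an orthogonal pair leaves out a free vertex k, then exchanging k for
    all elements of D below it, or just inserting k if there are none, is an
    operation that tightness forbids; conversely a non-free vertex cannot be
    inserted. So tightness says that every free vertex is used. *)
Lemma top_free e D U : acyclic e ->
  top e (D, U) <->
  [disjoint D & U] /\ (forall k, (k \in D :|: U) = free e D U k).
Proof.
move=> ac; split.
  move=> /(top_complete _ _ ac) [/orthogonal_free [dDU H] compl].
  split=> // k; apply/idP/idP => [/H //|/freeP [fD fU]].
  rewrite inE; apply: contraT; rewrite negb_or => /andP [kD kU].
  case: (compl k kD kU) => -[x xin exk].
    by have := fD x xin; rewrite exk.
  by have := fU x xin; rewrite exk.
case=> dDU H; apply/(top_complete _ _ ac); split.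
  by apply/orthogonal_free; split=> // k; rewrite H.
move=> k kD kU.
have : ~~ free e D U k by rewrite -H inE negb_or kD kU.
rewrite negb_and => /orP [] /forall_inPn [x xin /negbNE exk].
  by left; exists x.
by right; exists x.
Qed.

(** Read along edges, this is a recursion that computes D from U. *)
Lemma top_fst e D U k : acyclic e -> top e (D, U) ->
  (k \in D) = (k \notin U) && free e D U k.
Proof.
move=> ac /(top_free _ _ ac) [dDU <-]; rewrite inE.
case: (boolP (k \in U)) => [kU|_] /=; last by rewrite orbF.
by rewrite (disjointFl dDU kU).
Qed.

Lemma eq_top e f T : acyclic e -> acyclic f -> e =2 f -> top e T -> top f T.
Proof.
case: T => D U ace acf ef /(top_free _ _ ace) [dDU H].
apply/(top_free _ _ acf); split=> // k; rewrite H.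
by congr (_ && _); apply: eq_forallb => x; rewrite ef.
Qed.

(** * Linear extensions *)

(** Taking [x] in [rcons p g] covers two uses at once: the prefix is closed
    downwards, and everything directly below the next vertex is in it. *)
Lemma prefix_closed e p g s x y : linear_extension e (p ++ g :: s) ->
  x \in rcons p g -> e x y -> y \in p.
Proof.
case=> _ ext xin /ext; rewrite index_cat; case: ifP => // _ lt_yx.
suff /(leq_trans lt_yx) : index x (p ++ g :: s) <= size p.
  by rewrite ltnNge leq_addr.
rewrite -cat_rcons index_cat xin.
by move: xin; rewrite -index_mem size_rcons.
Qed.

Lemma extension_uniq e l : linear_extension e l -> uniq l.
Proof. by case=> /perm_uniq -> _; apply: enum_uniq. Qed.

Lemma extension_mem e l x : linear_extension e l -> x \in l.
Proof. by case=> /perm_mem -> _; rewrite mem_enum. Qed.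

Lemma next_notin e p g s : linear_extension e (p ++ g :: s) -> g \notin p.
Proof.
by move/extension_uniq; rewrite cat_uniq /= negb_or => /and3P [_ /andP []].
Qed.

(** Reversing the edges turns statements on linear extensions into statements
    on reverse linear extensions. *)
Lemma reverse_converse e l : reverse_linear_extension e l ->
  linear_extension (converse e) l.
Proof. by case=> pl ext; split=> // x y /ext. Qed.

Lemma extension_pairwise e l : linear_extension e l ->
  pairwise (fun x y => ~~ e x y) l.
Proof.
move=> lext; have ul := extension_uniq lext; case: lext => _ ext.
case: l ul ext => // x0 l ul ext; apply/(pairwiseP x0) => i j ii jj ij.
by apply/negP => /ext; rewrite !index_uniq // ltnNge ltnW.
Qed.

(** * Greedy completion *)

(** The greedy set is characterised by its own final value, not by its value
    when [k] is examined: the elements added after [k] have no edge to [k],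
    because of the order of [s]. [flip_addU] is the same procedure for the
    converse graph, up to conversion. *)
Lemma greedy_mem e D U s k : irreflexive e ->
  pairwise (fun x y => ~~ e y x) s ->
  let D' := foldl (flip_addD e U) D s in
  (k \in D') = (k \in D) || [&& k \in s, k \notin U & free e D' U k].
Proof.
move=> irr pw D'; rewrite {}/D'.
elim: s D pw k => [|a s IH] D /= => [_ k|/andP [/allP after_a pw] k].
  by rewrite orbF.
set D1 := flip_addD e U D a; set D' := foldl _ _ _.
have {}IH := IH D1 pw; rewrite -/D' in IH.
rewrite IH in_cons.
have sD1 : D \subset D1.
  by rewrite /D1 /flip_addD; case: ifP => // _; rewrite subsetUr.
have sD' : D1 \subset D' by apply/subsetP => x xD; rewrite IH xD.
have aE : (a \in D1) = (a \in D) || (a \notin U) && free e D' U a.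
  rewrite /D1 /flip_addD; case: ifP.
    case/and3P => aU nU nD; rewrite setU11 aU /=; apply/esym/orP; right.
    apply/andP; split=> //; apply/forall_inP => d.
    rewrite IH /D1 /flip_addD aU nU nD /= in_setU1 -orbA.
    case/or3P => [/eqP -> |dD|/and3P [ds _ _]]; first by rewrite irr.
      by move/forall_inP: nD; apply.
    exact: after_a.
  move=> nadd; apply/esym; case: (boolP (a \in D)) => //= _.
  apply/negbTE/negP => /andP [aU /(free_sub (subset_trans sD1 sD') (subxx U))].
  by move=> /andP [nD nU]; rewrite aU nU nD in nadd.
have [->|ka] := eqVneq k a; last first.
  rewrite /D1 /flip_addD; case: ifP => // _.
  by rewrite in_setU1 (negPf ka).
rewrite aE /=; case: (a \in D) => //=.
by case: (_ \notin U) => //=; case: (free _ _ _ a); rewrite ?andbF ?orbF.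
Qed.

(** An edge between two added vertices would contradict the order of [s] or
    the test made when the later one is added, so only edges from an added
    vertex to the initial set need a hypothesis. *)
Lemma greedy_orthogonal e D U s : irreflexive e ->
  pairwise (fun x y => ~~ e y x) s ->
  orthogonal_pair e (D, U) ->
  (forall k, k \in s -> k \notin U -> free e D U k ->
     forall d, d \in D -> ~~ e k d) ->
  orthogonal_pair e (foldl (flip_addD e U) D s, U).
Proof.
move=> irr pw /orthogonal_free [dDU oDU] noD.
have memD' := @greedy_mem e D U s _ irr pw.
set D' := foldl _ _ _ in memD' *.
have sD : D \subset D' by apply/subsetP => x xD; rewrite memD' xD.
apply/orthogonal_free; split.
  rewrite disjoints_subset; apply/subsetP => x; rewrite inE memD'.
  by case/orP => [xD|/and3P [_ //]]; rewrite (disjointFr dDU xD).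
have H k : k \in D :|: U -> free e D' U k.
  move=> kin; have /freeP [fD fU] := oDU k kin; apply/freeP; split=> // d.
  rewrite memD' => /orP [/fD //|/and3P [ds dU fr]].
  move: kin; rewrite inE => /orP [kD|kU].
    exact: noD ds dU (free_sub sD (subxx _) fr) _ kD.
  by case/freeP: fr => _; apply.
move=> k; rewrite inE => /orP [|kU]; last by apply: H; rewrite inE kU orbT.
rewrite memD' => /orP [kD|/and3P [] //].
by apply: H; rewrite inE kD.
Qed.

(** [L] and [M] stand for the vertices below and above [g], which a flip
    removes from [D] and [U]. If [k] had an edge to a kept [d], then [k] would
    be blocked in the old top. A blocker [x] with an edge to [k] is above [d],
    hence not in [L], and a blocker [x] reached from [k] is not in [M] since
    [k] is not: either way the blocker is kept, and [k] is still blocked.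
    Abstract [L] and [M] let the lemma be applied to the converse graph too. *)
Lemma unblocked_no_edge e D U (L M : pred V) k :
  (forall x, (x \in D :|: U) = free e D U x) ->
  (forall x y, e x y -> L x -> L y) -> (forall x y, e x y -> M y -> M x) ->
  let D0 := [set x in D | ~~ L x] in let U0 := [set x in U | ~~ M x] in
  ~~ M k -> k \notin U0 -> free e D0 U0 k ->
  forall d, d \in D0 -> ~~ e k d.
Proof.
move=> fDU Ldown Mup /= kM kU0 /freeP [fD fU] d; rewrite inE => /andP [dD dL].
apply/negP => ekd.
have /freeP [/= ndD _] : free e D U d by rewrite -fDU inE dD.
have kD : k \notin D by apply/negP => /ndD; rewrite ekd.
have kU : k \notin U by move: kU0; rewrite inE kM andbT.
have : ~~ free e D U k by rewrite -fDU inE negb_or kD.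
rewrite negb_and => /orP [] /forall_inPn [x xin /negbNE exk].
  have xL : ~~ L x by apply: contra dL => /(Ldown _ _ exk) /(Ldown _ _ ekd).
  by have := fD x; rewrite inE xin xL exk => /(_ isT).
have xM : ~~ M x by apply: contra kM; apply: Mup.
by have := fU x; rewrite inE xin xM exk => /(_ isT).
Qed.

(** * Flips *)

Lemma acyclic_irreflexive e : acyclic e -> irreflexive e.
Proof. by move=> ac x; have := ac x [::]; rewrite /= andbT => /negPf. Qed.

Lemma connect_up e g x y : e x y -> connect e y g -> connect e x g.
Proof. by move=> exy; apply/connect_trans/connect1. Qed.

Lemma connect_down e g x y : e x y -> connect e g x -> connect e g y.
Proof. by move=> exy cgx; apply: connect_trans cgx (connect1 exy). Qed.

Lemma connect_eq e x y : acyclic e -> connect e x y -> connect e y x -> x = y.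
Proof.
move=> ac /connectP [[|z p] /= pth ->] // cyx.
case/andP: pth => exz pth.
have := acyclic_edge ac exz => /negP [].
by apply: connect_trans cyx; apply/connectP; exists p.
Qed.

(** The invariant of both products: [D] has been transferred to the second
    component on the processed vertices [p], and is still the first component
    on the others. *)
Definition transferred D (p : seq V) T :=
  (forall k, k \in p -> (k \in T.2) = (k \in D)) /\
  (forall k, k \notin p -> (k \in T.1) = (k \in D)).

Section Flip.
Variables (e : rel V) (m m' : seq V) (g : V) (D U : {set V}).
Hypotheses (ac : acyclic e) (mext : linear_extension e m)
  (m'ext : reverse_linear_extension e m').

Let D0 := [set k in D | ~~ connect e g k].
Let U0 := [set k in U | ~~ connect e k g].
Let D1 := if g \in U then g |: D0 else D0.
Let U1 := if g \in D then g |: U0 else U0.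
Let s' := [seq k <- m' | ~~ connect e k g].
Let s := [seq k <- m | ~~ connect e g k].
Let D2 := foldl (flip_addD e U1) D1 s'.
Let U2 := foldl (flip_addU e D2) U1 s.

Let flipE : g \in D :|: U -> flip e m m' g (D, U) = (D2, U2).
Proof. by rewrite /flip => ->. Qed.

Let irr : irreflexive e. Proof. exact: acyclic_irreflexive. Qed.
Let irrC : irreflexive (converse e). Proof. by move=> x; apply: irr. Qed.

Let sorted_s' : pairwise (fun x y => ~~ e y x) s'.
Proof.
by apply/pairwise_filter/(extension_pairwise (reverse_converse m'ext)).
Qed.

Let sorted_s : pairwise (fun x y => ~~ converse e y x) s.
Proof. by apply/pairwise_filter/extension_pairwise. Qed.

Let mem_s' k : (k \in s') = ~~ connect e k g.
Proof.
by rewrite mem_filter (extension_mem k (reverse_converse m'ext)) andbT.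
Qed.

Let mem_s k : (k \in s) = ~~ connect e g k.
Proof. by rewrite mem_filter (extension_mem k mext) andbT. Qed.

Let mem_D2 k : (k \in D2) =
  (k \in D1) || [&& ~~ connect e k g, k \notin U1 & free e D2 U1 k].
Proof. by rewrite -mem_s'; apply: greedy_mem. Qed.

Let mem_U2 k : (k \in U2) =
  (k \in U1) || [&& ~~ connect e g k, k \notin D2 & free e D2 U2 k].
Proof.
by rewrite -mem_s -free_converse; apply: (@greedy_mem (converse e)).
Qed.

Let sD01 : D0 \subset D1.
Proof. by rewrite /D1; case: ifP => // _; rewrite subsetUr. Qed.
Let sU01 : U0 \subset U1.
Proof. by rewrite /U1; case: ifP => // _; rewrite subsetUr. Qed.
Let sD12 : D1 \subset D2.
Proof. by apply/subsetP => k kD; rewrite mem_D2 kD. Qed.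
Let sU12 : U1 \subset U2.
Proof. by apply/subsetP => k kU; rewrite mem_U2 kU. Qed.

Let mem_D1 k : k \in D1 -> k = g \/ k \in D0.
Proof.
by rewrite /D1; case: ifP; [rewrite in_setU1 => _ /predU1P | right].
Qed.
Let mem_U1 k : k \in U1 -> k = g \/ k \in U0.
Proof.
by rewrite /U1; case: ifP; [rewrite in_setU1 => _ /predU1P | right].
Qed.

Hypotheses (DUtop : top e (D, U)) (gin : g \in D :|: U).

Let dDU : [disjoint D & U].
Proof. by have [] := (top_free D U ac).1 DUtop. Qed.
Let memDU k : (k \in D :|: U) = free e D U k.
Proof. by have [] := (top_free D U ac).1 DUtop. Qed.

(** The only new edges to exclude are those at [g]. Orthogonality of the old
    top excludes those in one direction; in the other direction they would end
    below [g] or start above [g], where elements were discarded. *)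
Let start_orthogonal : orthogonal_pair e (D1, U1).
Proof.
have sD0 : D0 \subset D by apply/subsetP => x; rewrite inE => /andP [].
have sU0 : U0 \subset U by apply/subsetP => x; rewrite inE => /andP [].
have gD0 : g \notin D0 by rewrite inE connect0 andbF.
have gU0 : g \notin U0 by rewrite inE connect0 andbF.
have d0 : [disjoint D0 & U0] := disjointWl sD0 (disjointWr sU0 dDU).
have f0 k : k \in D :|: U -> free e D0 U0 k.
  by rewrite memDU; apply: free_sub.
have below k : k \in D0 -> ~~ e g k.
  by rewrite inE => /andP [_]; apply/contra/connect1.
have above k : k \in U0 -> ~~ e k g.
  by rewrite inE => /andP [_]; apply/contra/connect1.
have inDU k : k \in D0 :|: U0 -> k \in D :|: U.
  by apply/subsetP/setUSS.
apply/orthogonal_free; split.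
  rewrite /D1 /U1; case: (boolP (g \in U)) => gU.
    rewrite (disjointFl dDU gU) disjoints_subset subUset sub1set inE gU0.
    by rewrite -disjoints_subset.
  case: ifP => // _; rewrite disjoint_sym disjoints_subset subUset sub1set inE.
  by rewrite gD0 -disjoints_subset disjoint_sym.
move=> k kin; have kDU : k \in D :|: U.
  move: kin; rewrite inE => /orP [/mem_D1|/mem_U1] [-> //|kin];
  by apply: inDU; rewrite inE kin ?orbT.
have /freeP [fD fU] := f0 k kDU.
have /freeP [FD FU] : free e D U k by rewrite -memDU.
apply/freeP; split=> x.
  rewrite /D1; case: ifP => [gU|_ /fD //]; rewrite in_setU1.
  case/predU1P => [->|/fD //].
  move: kin; rewrite inE => /orP [/mem_D1 [->|/below //]|].
    by rewrite irr.
  rewrite /U1 (disjointFl dDU gU) => kU0.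
  have /freeP [_] : free e D U g by rewrite -memDU.
  by apply; apply: (subsetP sU0).
rewrite /U1; case: ifP => [gD|_ /fU //]; rewrite in_setU1.
case/predU1P => [->|/fU //].
move: kin; rewrite inE orbC => /orP [/mem_U1 [->|/above //]|].
  by rewrite irr.
rewrite /D1 (disjointFr dDU gD) => kD0.
have /freeP [+ _] : free e D U g by rewrite -memDU.
by apply; apply: (subsetP sD0).
Qed.

Let D_orthogonal : orthogonal_pair e (D2, U1).
Proof.
apply: greedy_orthogonal => // k; rewrite mem_s' => kg kU1 fr d.
case/mem_D1 => [->|]; first by apply: contra kg; apply: connect1.
apply: (unblocked_no_edge (L := connect e g) (M := fun x => connect e x g)
          memDU _ _ kg).
- by move=> x y; apply: connect_down.
- by move=> x y; apply: connect_up.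
- by apply: contra kU1; apply/subsetP.
- exact: free_sub fr.
Qed.

Let DU_orthogonal : orthogonal_pair e (D2, U2).
Proof.
apply/orthogonal_converse.
apply: (@greedy_orthogonal (converse e)) => //; first exact/orthogonal_converse.
move=> k; rewrite mem_s free_converse => kg kD2 fr u.
case/mem_U1 => [->|]; first by apply: contra kg; apply: (@connect1 _ e).
have memC x : (x \in U :|: D) = free (converse e) U D x.
  by rewrite free_converse setUC memDU.
apply: (unblocked_no_edge (L := fun x => connect e x g) (M := connect e g)
          memC _ _ kg).
- by move=> x y; apply: (@connect_up e g y x).
- by move=> x y; apply: (@connect_down e g y x).
- apply: contra kD2; apply/subsetP; exact: subset_trans sD01 sD12.
- rewrite free_converse; apply: free_sub fr => //.
  exact: subset_trans sD01 sD12.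
Qed.

(** A vertex not below [g] has been examined for [U2]. A vertex strictly below
    [g] is not above [g], so it has been examined for [D2]. *)
Let flip_pair_top : top e (D2, U2).
Proof.
have /orthogonal_free [dj fr] := DU_orthogonal.
apply/(top_free _ _ ac); split=> // k; apply/idP/idP => [/fr //|fk].
rewrite inE; case: (boolP (k \in D2)) => //= kD2.
rewrite mem_U2 kD2 fk andbT.
case: (boolP (k \in U1)) => //= kU1; apply: contraT; rewrite andbT negbK => cgk.
move: kD2; rewrite mem_D2 kU1 (free_sub (subxx _) sU12 fk) !andbT negb_or negbK.
case/andP => kD1 ckg; have E := connect_eq ac ckg cgk; subst k.
by move: kD1 kU1 gin; rewrite /D1 /U1 inE; do 2 case: ifP; rewrite ?setU11.
Qed.

(** From here on, [p] is the list of vertices flipped before [g]. *)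
Variable p : seq V.
Hypotheses (gp : g \notin p)
  (pdown : forall x y, x \in rcons p g -> e x y -> y \in p).

Let below_in k : connect e g k -> k \in rcons p g.
Proof.
case/connectP => q; elim/last_ind: q k => [|q z IH] k /=.
  by move=> _ ->; rewrite mem_rcons mem_head.
rewrite rcons_path last_rcons => /andP [pth ez] ->.
by rewrite mem_rcons in_cons (pdown (IH _ pth erefl) ez) orbT.
Qed.

Let not_above k : k \in p -> ~~ connect e k g.
Proof.
move=> kp; apply/negP => /connectP [q].
elim: q k kp => [|z q IH] k kp /=.
  by move=> _ E; have := gp; rewrite E kp.
case/andP => ekz; apply: IH.
by apply: pdown ekz; rewrite mem_rcons in_cons kp orbT.
Qed.

(** Elements of [D] with a path to [k] are not below [g], otherwise [k] would
    be below [g] too; so they are all kept. Elements of [U] reached from [k]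
    are kept when [k] is not above [g], and otherwise [k] is not examined. *)
Let flip_pair_fst k : k \notin rcons p g -> (k \in D2) = (k \in D).
Proof.
move=> kp; have ckg x : connect e x k -> ~~ connect e g x.
  move=> cxk; apply/negP => cgx; move/negP: kp; apply.
  exact/below_in/(connect_trans cgx).
have kg : k != g by apply: contraNneq kp => ->; rewrite mem_rcons mem_head.
have D0k x : connect e x k -> x \in D -> x \in D2.
  move=> cxk xD; apply: (subsetP sD12); apply: (subsetP sD01).
  by rewrite inE xD ckg.
apply/idP/idP => [|kD]; last exact: D0k kD.
rewrite mem_D2 => /orP [|].
  case/mem_D1 => [E|]; first by rewrite E eqxx in kg.
  by rewrite inE => /andP [].
case/and3P => kg' kU1 /freeP [fD fU].
have kept u : ~~ connect e u g -> u \in U -> u \in U1.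
  by move=> cu uU; apply: (subsetP sU01); rewrite inE uU.
have kU : k \notin U by apply: contra kU1; apply: kept.
rewrite (top_fst _ ac DUtop) kU; apply/freeP; split=> x xin.
  apply/negP => exk; have := fD x (D0k x (connect1 exk) xin).
  by rewrite exk.
apply/negP => ekx; have : ~~ connect e x g.
  by apply: contra kg'; apply: connect_up.
by move=> /kept /(_ xin) /fU; rewrite ekx.
Qed.

(** Symmetric to the above: [k], hence everything reached from it, is not
    above [g]. *)
Let flip_pair_snd k : k \in p -> (k \in U2) = (k \in U).
Proof.
move=> kp; have ckg := not_above kp.
have U1k x : ~~ connect e x g -> x \in U -> x \in U2.
  move=> cx xU; apply: (subsetP sU12); apply: (subsetP sU01).
  by rewrite inE xU.
apply/idP/idP => [|kU]; last exact: U1k.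
rewrite mem_U2 => /orP [|].
  case/mem_U1 => [E|]; first by have := gp; rewrite -E kp.
  by rewrite inE => /andP [].
case/and3P => kg' kD2 /freeP [fD fU].
have kept d : ~~ connect e g d -> d \in D -> d \in D2.
  move=> cd dD; apply: (subsetP sD12); apply: (subsetP sD01).
  by rewrite inE dD.
have kD : k \notin D by apply: contra kD2; apply: kept.
suff : k \in D :|: U by rewrite inE (negPf kD).
rewrite memDU; apply/freeP; split=> x xin.
  apply/negP => exk; have : ~~ connect e g x.
    by apply: contra kg'; apply: connect_down.
  by move=> /kept /(_ xin) /fD; rewrite exk.
apply/negP => ekx; have : ~~ connect e x g.
  by apply: contra ckg; apply: connect_up.
by move=> /U1k /(_ xin) /fU; rewrite ekx.
Qed.

Let flip_pair_pivot : (g \in U2) = (g \in D).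
Proof.
rewrite mem_U2 connect0 orbF /U1; case: ifP => gD; first exact: setU11.
by rewrite inE connect0 andbF.
Qed.

Lemma flip_top : top e (flip e m m' g (D, U)).
Proof. by rewrite flipE. Qed.

Lemma flip_transfers D' : transferred D' p (D, U) ->
  transferred D' (rcons p g) (flip e m m' g (D, U)).
Proof.
rewrite flipE // => -[/= inp notinp]; split=> k /= kp.
  move: kp; rewrite mem_rcons in_cons => /predU1P [->|kp].
    by rewrite flip_pair_pivot notinp.
  by rewrite flip_pair_snd // inp.
rewrite flip_pair_fst // notinp //; apply: contra kp.
by rewrite mem_rcons in_cons => ->; rewrite orbT.
Qed.

End Flip.

(** When [g] belongs to neither component the flip is the identity, and [g] is
    not in [D] by the invariant, so it may join the processed vertices. *)
Lemma flip_step e (m m' : seq V) g p D T : acyclic e ->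
  linear_extension e m -> reverse_linear_extension e m' ->
  g \notin p -> (forall x y, x \in rcons p g -> e x y -> y \in p) ->
  top e T -> transferred D p T ->
  top e (flip e m m' g T) /\ transferred D (rcons p g) (flip e m m' g T).
Proof.
case: T => D1 U1 ac mext m'ext gp pdown tT tr.
have [gin|gout] := boolP (g \in D1 :|: U1).
  by split; [apply: flip_top | apply: flip_transfers].
rewrite /flip gout; split=> //; case: tr => inp notinp.
move: gout; rewrite inE negb_or => /andP [gD gU].
split=> k; rewrite mem_rcons in_cons.
  case/predU1P => [->|/inp //]; rewrite -notinp //.
  by rewrite (negPf gD) (negPf gU).
by rewrite negb_or => /andP [_ /notinp].
Qed.

Lemma row_of_transferred e p T T' : acyclic e -> (forall x, x \in p) ->
  top e T -> top e T' -> transferred T.1 p T' -> row e T = T'.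
Proof.
move=> ac allp tT tT' [inp _]; have [_ _ uniqT] := row_spec ac tT.
by apply/esym/uniqT => //; apply/setP => k; apply: inp.
Qed.

Lemma row_flips e (l : seq V) (m m' : V -> seq V) T : acyclic e ->
  linear_extension e l -> (forall g, linear_extension e (m g)) ->
  (forall g, reverse_linear_extension e (m' g)) -> top e T ->
  row e T = foldl (fun S g => flip e (m g) (m' g) g S) T l.
Proof.
move=> ac lext mext m'ext tT; set F := fun S g => _.
suff main q p T' : l = p ++ q -> top e T' -> transferred T.1 p T' ->
    top e (foldl F T' q) /\ transferred T.1 l (foldl F T' q).
  have [//|//|//|tR tr] := main l [::] T.
  by apply: row_of_transferred tr => // x; apply: extension_mem lext.
elim: q p T' => [|g q IH] p T' El tT' tr /=.
  by rewrite El cats0.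
have lext' : linear_extension e (p ++ g :: q) by rewrite -El.
have [tR trR] := flip_step ac (mext g) (m'ext g) (next_notin lext')
  (fun x y => prefix_closed lext') tT' tr.
by apply: IH trR => //; rewrite cat_rcons.
Qed.

(** * Toggles *)

(** Toggling the vertices of [p] reverses twice the edges inside [p]. *)
Definition cut_graph e (p : seq V) : rel V :=
  fun x y => if (x \in p) (+) (y \in p) then e y x else e x y.

Lemma tog_cut_graph e f p g : f =2 cut_graph e p -> g \notin p ->
  tog_graph g f =2 cut_graph e (rcons p g).
Proof.
move=> fE /negPf gp x y.
rewrite /tog_graph !fE /cut_graph !mem_rcons !in_cons.
by have [->|xg] := eqVneq x g; have [->|yg] := eqVneq y g;
   rewrite /= ?gp ?addbT ?addbF //=; case: (_ \in p).
Qed.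

Lemma cut_graph_max e f p g : f =2 cut_graph e p -> g \notin p ->
  (forall x y, x \in rcons p g -> e y x -> y \in p) -> forall x, ~~ f x g.
Proof.
move=> fE gp pup x; have gin : g \in rcons p g by rewrite mem_rcons mem_head.
rewrite fE /cut_graph (negPf gp) addbF; case: ifP => xp; apply/negP.
  move=> egx; move/negP: gp; apply; apply: pup egx.
  by rewrite mem_rcons in_cons xp orbT.
by move/(pup _ _ gin); rewrite xp.
Qed.

(** Induction along the edges of [f] with the recursion [top_fst]. An edge of
    [f] into a vertex off [p] cannot start in [p], since its reverse would be
    an edge of [e] into [p], which is closed upwards. *)
Lemma tog_fst_outside e f p g D U D' : acyclic f -> f =2 cut_graph e p ->
  g \notin p -> (forall x y, x \in rcons p g -> e y x -> y \in p) ->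
  g \notin D -> top f (D, U) -> top (tog_graph g f) (D', U :\ g) ->
  forall k, k \notin rcons p g -> (k \in D') = (k \in D).
Proof.
move=> ac fE gp pup gD tT tT' k.
have gmax := cut_graph_max fE gp pup.
have ac' := tog_graph_acyclic ac gmax.
have [n] := ubnP (nancestors f k); elim: n k => // n IH k /ltnSE le_n kp.
have [kg kp0] : k != g /\ k \notin p.
  by apply/andP; move: kp; rewrite mem_rcons in_cons negb_or.
have edge d : d != g -> tog_graph g f d k = f d k.
  by move=> dg; rewrite /tog_graph (negPf dg) (negPf kg).
rewrite (top_fst _ ac' tT') (top_fst _ ac tT) in_setD1 kg /=.
congr (_ && (_ && _)); apply: eq_forallb => x.
  have [->|xg] := eqVneq x g.
    by rewrite (negPf gD) /tog_graph eqxx /= (negPf (gmax k)) implybT.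
  rewrite edge //; case: (boolP (f x k)) => [fxk|_]; last by rewrite !implybT.
  rewrite IH //; first exact: leq_trans (nancestors_edge ac fxk) le_n.
  rewrite mem_rcons in_cons (negPf xg) /=; apply/negP => xp.
  move: fxk; rewrite fE /cut_graph xp (negPf kp0) /= => ekx.
  by move/negP: kp0; apply; apply: pup ekx; rewrite mem_rcons in_cons xp orbT.
rewrite in_setD1; have [->|xg] /= := eqVneq x g.
  by rewrite (negPf (gmax k)) implybT.
by rewrite /tog_graph (negPf xg) (negPf kg).
Qed.

Lemma tog_step_transfers e f p g D T : acyclic f -> f =2 cut_graph e p ->
  g \notin p -> (forall x y, x \in rcons p g -> e y x -> y \in p) ->
  top f T -> transferred D p T -> transferred D (rcons p g) (tog f g T).
Proof.
case: T => D1 U1 ac fE gp pup tT [/= inp notinp].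
have gmax := cut_graph_max fE gp pup.
have ac' := tog_graph_acyclic ac gmax.
have := tog_top ac gmax tT; rewrite /tog /=; case: ifP => gD1 tT'.
  split=> k; rewrite mem_rcons in_cons /=.
    rewrite in_setU1; have [->|_ /= /inp //] := eqVneq k g.
    by rewrite -notinp // gD1.
  by rewrite in_setD1 negb_or => /andP [-> /notinp].
have iU : independent (tog_graph g f) (U1 :\ g).
  apply: tog_graph_indep; last by rewrite setD11.
  have /andP [/and4P [_ /forall_inP iU _ _] _] := tT.
  apply/forall_inP => x /setD1P [_ /iU /forall_inP iUx].
  by apply/forall_inP => y /setD1P [_ /iUx].
have [_ E] := top_with_snd_spec ac' iU.
move: tT' E; case: (top_with_snd _ _) => D2 U2 /= tT' E; subst U2.
split=> k /= kp.
  rewrite in_setD1; move: kp; rewrite mem_rcons in_cons.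
  have [->|_ /= /inp //] := eqVneq k g.
  by rewrite -notinp // gD1.
rewrite (tog_fst_outside ac fE gp pup (negbT gD1) tT tT' kp) notinp //.
by apply: contra kp; rewrite mem_rcons in_cons => ->; rewrite orbT.
Qed.

Lemma row_toggles e (l' : seq V) T : acyclic e ->
  reverse_linear_extension e l' -> top e T ->
  (toggles e l' T).1 =2 e /\ row e T = (toggles e l' T).2.
Proof.
move=> ac /reverse_converse l'ext tT.
suff main q p f T' : l' = p ++ q -> acyclic f -> f =2 cut_graph e p ->
    top f T' -> transferred T.1 p T' ->
    let S := foldl (@tog_step V) (f, T') q in
    [/\ acyclic S.1, S.1 =2 cut_graph e l', top S.1 S.2
       & transferred T.1 l' S.2].
  have [//|//|//|//|//|acS SE tS trS] := main l' [::] e T.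
  have SE' : (toggles e l' T).1 =2 e.
    by move=> x y; rewrite SE /cut_graph !(extension_mem _ l'ext).
  split=> //; apply: row_of_transferred trS => //.
    by move=> x; apply: extension_mem l'ext.
  exact: eq_top acS ac SE' tS.
elim: q p f T' => [|g q IH] p f T' El acf fE tT' tr; first by rewrite El cats0.
have l'ext' : linear_extension (converse e) (p ++ g :: q) by rewrite -El.
have gp := next_notin l'ext'.
have pup x y : x \in rcons p g -> e y x -> y \in p := prefix_closed l'ext'.
have gmax := cut_graph_max fE gp pup.
apply: (IH (rcons p g)).
- by rewrite cat_rcons.
- exact: tog_graph_acyclic.
- exact: tog_cut_graph.
- exact: tog_top.
- exact: tog_step_transfers tr.
Qed.

End Rowmotion.

Theorem theorem1p8 (V : finType) (e : rel V) (e_acyclic : acyclic e)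
    (l l' : seq V) (l_ext : linear_extension e l)
    (l'_ext : reverse_linear_extension e l')
    (m m' : V -> seq V)
    (m_ext : forall g, linear_extension e (m g))
    (m'_ext : forall g, reverse_linear_extension e (m' g))
    (T : {set V} * {set V}) (T_top : top e T) :
  [/\ row e T = foldl (fun S g => flip e (m g) (m' g) g S) T l,
      (toggles e l' T).1 =2 e
    & row e T = (toggles e l' T).2].
Proof.
have [graphE rowE] := row_toggles e_acyclic l'_ext T_top.
by split=> //; apply: row_flips.
Qed.
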